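(* Let $A$ be a Banach algebra such that every closed ideal of $A$ admits a quasi-central approximate identity in $A$. Then a closed subspace $L$ of $A$ is a Lie ideal if and only if there exists a closed ideal $I$ in $A$ such that $$\overline{[I,A]}\subseteq L\subseteq N(\overline{[I,A]}).$$
   Context: All algebras are complex and ideals are two-sided. For elements $x,y$, $[x,y]:=xy-yx$; for subspaces $X,Y$ of $A$, $[X,Y]:=\mathrm{span}\{[x,y]:x\in X,\,y\in Y\}$. A subspace $L$ of $A$ is a Lie ideal if $[a,x]\in L$ for all $a\in A$, $x\in L$. For a subspace $S\subseteq A$, $N(S):=\{x\in A:[x,a]\in S\text{ for all }a\in A\}$. Bars denote norm closures. A quasi-central approximate identity for an ideal $I$ in a Banach algebra $A$ is a net $\{e_\lambda\}$ in $I$ with $\sup_\lambda\|e_\lambda\|<\infty$ and $\lim_\lambda\|xe_\lambda-x\|=\lim_\lambda\|e_\lambda x-x\|=\lim_\lambda\|e_\lambda a-ae_\lambda\|=0$ for all $x\in I$, $a\in A$. *)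

(* Defs.v *)
From HB Require Import structures.
From mathcomp Require Import all_boot all_order all_algebra.
From mathcomp Require Import complex.
From mathcomp Require Import all_classical all_reals all_analysis.

Set Implicit Arguments.
Unset Strict Implicit.
Unset Printing Implicit Defensive.

Import Order.TTheory GRing.Theory Num.Theory.
Import numFieldNormedType.Exports.

Local Open Scope classical_set_scope.
Local Open Scope ring_scope.

(* The ring structures of MathComp are all unital, whereas a Banach algebra
   need not have a unit; hence a product of its own on a complete normed
   space. *)
HB.mixin Record CompleteNormedModule_isBanachAlgebra (K : numFieldType) A
    of CompleteNormedModule K A := {
  bmul : A -> A -> A ;
  bmulA : associative bmul ;
  bmulDl : left_distributive bmul +%R ;
  bmulDr : right_distributive bmul +%R ;
  bmulZl : forall (k : K) (x y : A), bmul (k *: x) y = k *: bmul x y ;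
  bmulZr : forall (k : K) (x y : A), bmul x (k *: y) = k *: bmul x y ;
  normr_bmul_le : forall x y : A, `|bmul x y| <= `|x| * `|y|
}.

#[short(type="banachAlgebraType")]
HB.structure Definition BanachAlgebra (K : numFieldType) :=
  {A of CompleteNormedModule_isBanachAlgebra K A & CompleteNormedModule K A}.

Section Algebra.
Context {K : numFieldType} {A : banachAlgebraType K}.
Implicit Types (x y a : A) (S X Y I L : set A).

Definition linear_subspace S := submod_closed (mem S).

Definition linear_span X : set A := smallest linear_subspace X.

Definition two_sided_ideal I :=
  linear_subspace I /\ forall a x, I x -> I (bmul a x) /\ I (bmul x a).

Definition bracket x y : A := bmul x y - bmul y x.

Definition bracket_span X Y : set A :=
  linear_span [set z | exists x y, [/\ X x, Y y & z = bracket x y]].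

Definition lie_ideal L :=
  linear_subspace L /\ forall a x, L x -> L (bracket a x).

Definition bracket_into S : set A := [set x | forall a, S (bracket x a)].

End Algebra.

Definition directed (D : Type) (le : D -> D -> Prop) :=
  [/\ inhabited D,
      forall i, le i i,
      forall i j k, le i j -> le j k -> le i k &
      forall i j, exists k, le i k /\ le j k].

Definition tails (D : Type) (le : D -> D -> Prop) : set_system D :=
  filter_from setT (fun i => [set j | le i j]).

(* As the norm takes its values in the scalar field K, the limits below are
   taken in K; for K = R[i], a bound M is necessarily a nonnegative real. *)
Definition quasi_central_approximate_identity (K : numFieldType)
    (A : banachAlgebraType K) (I : set A)
    (D : Type) (le : D -> D -> Prop) (e : D -> A) :=
  [/\ directed le,
      forall i, I (e i),
      exists M : K, forall i, `|e i| <= M,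
      forall x, I x ->
        `|bmul x (e i) - x| @[i --> tails le] --> (0 : K) /\
        `|bmul (e i) x - x| @[i --> tails le] --> (0 : K) &
      forall a, `|bmul (e i) a - bmul a (e i)| @[i --> tails le] --> (0 : K)].

Definition admits_quasi_central_approximate_identity (K : numFieldType)
    (A : banachAlgebraType K) (I : set A) :=
  exists (D : Type) (le : D -> D -> Prop) (e : D -> A),
    quasi_central_approximate_identity I le e.

(* Main.v *)
Require Import Defs.
From HB Require Import structures.
From mathcomp Require Import all_boot all_order all_algebra.
From mathcomp Require Import complex.
From mathcomp Require Import all_classical all_reals all_analysis.
Import Order.TTheory GRing.Theory Num.Theory.
Import numFieldNormedType.Exports.
Local Open Scope classical_set_scope.
Local Open Scope ring_scope.

(** For the direct implication, let I be the closed ideal generated by [L, L].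

    The identities [y u, b] = [y, u b] + [u, b y] and
    [x, y a] = [x, y] a + y [x, a] show that the elements w with [w, A] and
    [w A, A] inside L form a closed ideal containing [L, L]; hence [I, A] lies
    in L.

    Approximate identities make every closed ideal semiprime: if z A z lies in
    I, so does z e' e for all e and e' in the closed ideal generated by z, and
    z is a limit of such elements.  For x in L and d = [x, .], the map d^2
    vanishes modulo I, hence so does 2 (d a)(d b), and then (d a) b (d a);
    therefore [L, A] lies in I.

    Finally, if (e_i) is a quasi-central approximate identity of I, then
    [x, a e_i] = [x, a] e_i + a [x, e_i] tends to [x, a], so that [x, a] is
    in the closure of [I, A]. *)

Section BanachAlgebra.
Context {K : numFieldType} {A : banachAlgebraType K}.
Implicit Types (x y z u v w a b c : A) (S X Y I J L : set A).

(** * Subspaces and bracket identities *)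

Lemma linear_subspaceP S :
  linear_subspace S <->
  S 0 /\ forall (k : K) u v, S u -> S v -> S (k *: u + v).
Proof.
split=> -[S0 SD]; split.
- by rewrite -in_setE.
- by move=> k u v Su Sv; rewrite -in_setE; apply: SD; rewrite in_setE.
- by rewrite in_setE.
- by move=> k u v; rewrite !in_setE; exact: SD.
Qed.

Lemma linear_subspaceD S x y : linear_subspace S -> S x -> S y -> S (x + y).
Proof.
by move=> /linear_subspaceP[_ SD] Sx Sy; rewrite -[x]scale1r; exact: SD.
Qed.

Lemma linear_subspaceZ S (k : K) x : linear_subspace S -> S x -> S (k *: x).
Proof.
by move=> /linear_subspaceP[S0 SD] Sx; rewrite -[_ *: _]addr0; exact: SD.
Qed.

Lemma linear_subspaceN S x : linear_subspace S -> S x -> S (- x).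
Proof. by move=> hS Sx; rewrite -scaleN1r; exact: linear_subspaceZ. Qed.

Lemma linear_subspaceB S x y : linear_subspace S -> S x -> S y -> S (x - y).
Proof.
by move=> hS Sx Sy; apply: linear_subspaceD => //; exact: linear_subspaceN.
Qed.

Lemma bmul0l x : bmul 0 x = 0 :> A.
Proof. by apply: (addrI (bmul 0 x)); rewrite -bmulDl !addr0. Qed.

Lemma bmul0r x : bmul x 0 = 0 :> A.
Proof. by apply: (addrI (bmul x 0)); rewrite -bmulDr !addr0. Qed.

Lemma bmulNl x y : bmul (- x) y = - bmul x y.
Proof. by rewrite -scaleN1r bmulZl scaleN1r. Qed.

Lemma bmulNr x y : bmul x (- y) = - bmul x y.
Proof. by rewrite -scaleN1r bmulZr scaleN1r. Qed.

Lemma bmulBl x y z : bmul (x - y) z = bmul x z - bmul y z.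
Proof. by rewrite bmulDl bmulNl. Qed.

Lemma bmulBr x y z : bmul x (y - z) = bmul x y - bmul x z.
Proof. by rewrite bmulDr bmulNr. Qed.

Lemma bracketN x y : - bracket x y = bracket y x.
Proof. by rewrite opprB. Qed.

Lemma bracketDr x y z : bracket x (y + z) = bracket x y + bracket x z.
Proof. by rewrite /bracket bmulDl bmulDr opprD addrACA. Qed.

Lemma bracketDl x y z : bracket (x + y) z = bracket x z + bracket y z.
Proof. by rewrite -bracketN bracketDr opprD !bracketN. Qed.

Lemma bracketZl (k : K) x y : bracket (k *: x) y = k *: bracket x y.
Proof. by rewrite /bracket bmulZl bmulZr scalerBr. Qed.

Lemma bracket0l x : bracket 0 x = 0.
Proof. by rewrite /bracket bmul0l bmul0r subrr. Qed.

Lemma bracketMr x y a :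
  bracket x (bmul y a) = bmul (bracket x y) a + bmul y (bracket x a).
Proof. by rewrite /bracket bmulBl bmulBr !bmulA subrKA. Qed.

(** The two terms [u b y] cancel. This trades a product in the left slot for brackets with its
    single factors, which membership in a Lie ideal can control. *)
Lemma bracketM_cycle y u b :
  bracket (bmul y u) b = bracket y (bmul u b) + bracket u (bmul b y).
Proof. by rewrite /bracket !bmulA subrKA. Qed.

(** * Continuity of the product and the bracket *)

Lemma lipschitz_continuous (f : A -> A) (C : K) :
  0 <= C -> (forall x y, `|f x - f y| <= C * `|x - y|) -> continuous f.
Proof.
move=> C0 fC x; apply/cvgrPdist_lt => e e0.
(* [C] may vanish, so the division is by [C + 1]. *)
have C1 : 0 < C + 1 by rewrite ltr_wpDl.
near=> y; apply: le_lt_trans (fC x y) _.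
apply: (@le_lt_trans _ _ ((C + 1) * `|x - y|)).
  by rewrite ler_wpM2r// lerDl.
rewrite -ltr_pdivlMl// mulrC.
near: y.
by have /cvgrPdist_lt := @cvg_id _ (nbhs x); apply; rewrite divr_gt0.
Unshelve. all: by end_near. Qed.

Lemma bmul_continuousl a : continuous (fun x => bmul x a).
Proof.
apply: (@lipschitz_continuous _ `|a|) => // x y.
by rewrite -bmulBl mulrC normr_bmul_le.
Qed.

Lemma bmul_continuousr a : continuous (bmul a).
Proof.
apply: (@lipschitz_continuous _ `|a|) => // x y.
by rewrite -bmulBr normr_bmul_le.
Qed.

Lemma bracket_continuousl a : continuous (fun x => bracket x a).
Proof.
move=> x; apply: cvgB; [exact: bmul_continuousl|exact: bmul_continuousr].
Qed.

(** * Closed ideals and their brackets inside a Lie ideal *)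

Definition closed_ideal I := closed I /\ two_sided_ideal I.

Definition closed_ideal_span X := smallest closed_ideal X.

Lemma closed_ideal_span_closed_ideal X : closed_ideal (closed_ideal_span X).
Proof.
split; first by apply: closed_bigI => I [[]].
split; last by move=> a x Jx; split=> I hI; have [[_ [_ Imul]] _] := hI;
  have [] := Imul a x (Jx I hI).
apply/linear_subspaceP; split.
  by move=> I [[_ [/linear_subspaceP[I0 _] _]] _].
move=> k u v Ju Jv I hI; have [[_ [/linear_subspaceP[_ ID] _]] _] := hI.
by apply: ID; [exact: Ju|exact: Jv].
Qed.

Lemma bracket_span_sub I J L :
  linear_subspace L -> (forall x y, I x -> J y -> L (bracket x y)) ->
  bracket_span I J `<=` L.
Proof.
by move=> hL IJL; apply: smallest_sub => // _ [x [y [Ix Jy ->]]]; exact: IJL.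
Qed.

Lemma bracket_span_bracket I J x y :
  I x -> J y -> bracket_span I J (bracket x y).
Proof. by move=> Ix Jy; apply: sub_gen_smallest; exists x, y. Qed.

Lemma tails_proper_filter (D : Type) (le : D -> D -> Prop) :
  directed le -> ProperFilter (tails le).
Proof.
move=> [[i0] le_refl le_trans le_ub]; apply: filter_from_proper.
  apply: filter_from_filter; first by exists i0.
  move=> i j _ _; have [k [ik jk]] := le_ub i j.
  by exists k => // l kl; split; exact: le_trans kl.
by move=> i _; exists i; exact: le_refl.
Qed.

(** The clause on [w a] builds in stability under right multiplication; stability under left
    multiplication then follows from [bracketM_cycle]. *)
Definition bracket_core L : set A :=
  [set w | forall b, L (bracket w b) /\ forall a, L (bracket (bmul w a) b)].

Lemma closed_ideal_bracket_core L :
  lie_ideal L -> closed L -> closed_ideal (bracket_core L).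
Proof.
move=> [hL Lbr] Lc.
have [L0 LD] := (linear_subspaceP L).1 hL.
split.
  have -> : bracket_core L = \bigcap_b ((fun w => bracket w b) @^-1` L `&`
          \bigcap_a ((fun w => bracket (bmul w a) b) @^-1` L)).
    by apply/seteqP; split=> w hw b => [_|]; have [] := hw b => // h1 h2;
      split=> // a; have := h2 a; exact.
  apply: closed_bigI => b _; apply: closedI.
    by apply: (continuous_closedP _).1 => //; exact: bracket_continuousl.
  apply: closed_bigI => a _.
  apply: ((continuous_closedP _).1 (bmul_continuousl a)
    ((fun w => bracket w b) @^-1` L)).
  by apply: (continuous_closedP _).1 => //; exact: bracket_continuousl.
split.
  apply/linear_subspaceP; split=> [b|k u v hu hv b].
    by rewrite bracket0l; split=> // a; rewrite bmul0l bracket0l.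
  have [ub uab] := hu b; have [vb vab] := hv b.
  rewrite bracketDl bracketZl; split=> [|a]; first exact: LD.
  by rewrite bmulDl bmulZl bracketDl bracketZl; exact: LD.
move=> c w hw.
have wL v : L (bracket w v) by have [] := hw v.
have waL a v : L (bracket (bmul w a) v) by have [] := hw v.
split=> b; split=> [|a].
(* Here [[c w, b] = - [w b, c] + [w, b c]], and both brackets are controlled by the hypothesis on
   [w]. The next case replaces [w] by [w a]. *)
- rewrite bracketM_cycle -[bracket c _]bracketN.
  by apply: linear_subspaceD => //; exact: linear_subspaceN.
- rewrite -bmulA bracketM_cycle -[bracket c _]bracketN -bmulA.
  by apply: linear_subspaceD => //; exact: linear_subspaceN.
- exact: waL.
- by rewrite -bmulA; exact: waL.
Qed.

Lemma bracket_ideal_span_sub L : lie_ideal L -> closed L ->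
  forall w b, closed_ideal_span (bracket_span L L) w -> L (bracket w b).
Proof.
move=> hLie Lc w b.
have [hL Lbr] := hLie.
have Lbl x c : L x -> L (bracket x c).
  by move=> Lx; rewrite -bracketN; apply: linear_subspaceN => //; exact: Lbr.
have [Tc Tid] := closed_ideal_bracket_core L hLie Lc.
move=> Jw.
suff /(_ w Jw b)[] :
  closed_ideal_span (bracket_span L L) `<=` bracket_core L by [].
apply: smallest_sub => //; apply: bracket_span_sub; first by have [] := Tid.
move=> x y Lx Ly c; split=> [|a]; first exact/Lbl/Lbr.
(* The element [[x, y a]] is in [L], hence so is its bracket with [c]. The other term gives [[y,
   [x, a] c] + [[x, a], c y]], where [y] and [[x, a]] are in [L]. *)
have -> : bmul (bracket x y) a = bracket x (bmul y a) - bmul y (bracket x a).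
  by rewrite bracketMr addrK.
rewrite bracketDl -scaleN1r bracketZl scaleN1r bracketM_cycle.
apply: linear_subspaceB => //; first exact/Lbl/Lbl.
by apply: linear_subspaceD => //; [exact: Lbl|exact/Lbl/Lbl].
Qed.

(** * Consequences of approximate identities *)

Section ApproximateIdentity.
Hypothesis hA : forall I : set A, closed I -> two_sided_ideal I ->
  admits_quasi_central_approximate_identity I.

Lemma closed_ideal_semiprime I z : closed_ideal I ->
  (forall a, I (bmul (bmul z a) z)) -> I z.
Proof.
move=> [Ic [hI Imul]] zAz.
pose J := closed_ideal_span [set z].
have [Jc Jid] := closed_ideal_span_closed_ideal [set z].
have [I0 ID] := (linear_subspaceP I).1 hI.
(* The right-hand side is a closed ideal, since [z a (b k) = z (a b) k], and it contains [z]. *)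
have JI : J `<=` [set k | forall a, I (bmul (bmul z a) k)].
  apply: smallest_sub; last by move=> _ ->.
  split.
    have -> : [set k | forall a, I (bmul (bmul z a) k)] =
        \bigcap_a (bmul (bmul z a) @^-1` I).
      by apply/seteqP; split=> k hk a => [_|]; have := hk a; [|apply].
    apply: closed_bigI => a _; apply: (continuous_closedP _).1 => //.
    exact: bmul_continuousr.
  split.
    apply/linear_subspaceP; split=> [a|k u v hu hv a]; first by rewrite bmul0r.
    by rewrite bmulDr bmulZr; exact: ID.
  move=> b k hk; split=> a; first by rewrite bmulA -(bmulA z).
  by rewrite bmulA; have [] := Imul b _ (hk a).
have [D [le [e [dir eJ _ eid _]]]] := hA J Jc Jid.
have Jz : J z by apply: sub_gen_smallest.
have FF := tails_proper_filter D le dir.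
have [zez _] := eid z Jz.
have ze : bmul z (e i) @[i --> tails le] --> z.
  by apply/subr_cvg0/norm_cvg0P.
(* Two iterated limits along the same net: for fixed [i], [z e_j e_i] tends to [z e_i] in [j], and
   then [z e_i] tends to [z]. *)
apply: (closed_cvg (u_ := fun i => bmul z (e i)) I Ic _ z ze).
apply: nearW => i.
have zee : bmul (bmul z (e j)) (e i) @[j --> tails le] --> bmul z (e i).
  exact: (cvg_comp _ _ ze (bmul_continuousl (e i) z)).
apply: (closed_cvg (u_ := fun j => bmul (bmul z (e j)) (e i)) I Ic _ _ zee).
by apply: nearW => j; exact/JI.
Qed.

Lemma bracket_mem_closed_ideal L I : lie_ideal L -> closed_ideal I ->
  (forall x y, L x -> L y -> I (bracket x y)) ->
  forall x a, L x -> I (bracket x a).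
Proof.
move=> [hL Lbr] hI LLI x a Lx; have [_ [Isub Imul]] := hI.
have d2 b : I (bracket x (bracket x b)).
  apply: LLI => //; rewrite -bracketN.
  by apply: linear_subspaceN => //; exact: Lbr.
have dd b c : I (bmul (bracket x b) (bracket x c)).
  set t := bmul _ _.
  (* Second-order Leibniz rule for the derivation [[x, .]]; by [d2], everything but the cross term
     [t + t] lies in [I]. *)
  have d2M : bracket x (bracket x (bmul b c)) =
      bmul (bracket x (bracket x b)) c + (t + t) +
      bmul b (bracket x (bracket x c)).
    by rewrite bracketMr bracketDr !bracketMr !addrA.
  have tt : I (t + t).
    have -> : t + t = bracket x (bracket x (bmul b c))
        - bmul (bracket x (bracket x b)) c - bmul b (bracket x (bracket x c)).
      by rewrite d2M addrAC addrK addrC addKr.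
    apply: linear_subspaceB => //; last by have [] := Imul b _ (d2 c).
    by apply: linear_subspaceB => //; have [] := Imul c _ (d2 b).
  have -> : t = 2^-1 *: (t + t).
    by rewrite -mulr2n -[t *+ 2]scaler_nat scalerA mulVf ?scale1r// pnatr_eq0.
  exact: linear_subspaceZ.
apply: closed_ideal_semiprime => // b.
(* With [d = [x, .]], the Leibniz rule for [d (b a)] gives [(d a) b (d a) = (d a) d(b a) - (d a) (d
   b) a], and [dd] applies to both terms. *)
have -> : bmul (bmul (bracket x a) b) (bracket x a) =
    bmul (bracket x a) (bracket x (bmul b a))
    - bmul (bmul (bracket x a) (bracket x b)) a.
  by rewrite bracketMr [X in X - _]bmulDr !bmulA [X in X - _]addrC addrK.
apply: linear_subspaceB => //.
by have [] := Imul a _ (dd a b).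
Qed.

Lemma bracket_mem_closure I x a : closed_ideal I ->
  I (bracket x a) -> closure (bracket_span I setT) (bracket x a).
Proof.
move=> [Ic Iid] Ixa; have [Isub Imul] := Iid.
have [D [le [e [dir eI _ eid ec]]]] := hA I Ic Iid.
have FF := tails_proper_filter D le dir.
have [xae _] := eid _ Ixa.
have xae_cvg : bmul (bracket x a) (e i) @[i --> tails le] --> bracket x a.
  by apply/subr_cvg0/norm_cvg0P.
have ex_cvg : bracket (e i) x @[i --> tails le] --> (0 : A).
  exact/norm_cvg0P/ec.
have axe_cvg : bmul a (bracket (e i) x) @[i --> tails le] --> (0 : A).
  by rewrite -(bmul0r a); exact: (cvg_comp _ _ ex_cvg (bmul_continuousr a 0)).
(* The sign turns [[x, a e_i]] into a bracket whose left slot holds the ideal element [a e_i]; [x]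
   itself may lie outside [I]. *)
have : bracket (bmul a (e i)) (- x) @[i --> tails le] --> bracket x a.
  rewrite -[bracket x a]subr0.
  have -> : (fun i => bracket (bmul a (e i)) (- x)) =
      (fun i => bmul (bracket x a) (e i) - bmul a (bracket (e i) x)).
    apply/funext => i.
    rewrite -[bracket (e i) x]bracketN bmulNr opprK -bracketMr.
    by rewrite /bracket bmulNl bmulNr opprK addrC.
  exact: cvgB.
apply: closed_cvg; first exact: closed_closure.
apply: nearW => i; apply: subset_closure; apply: bracket_span_bracket => //.
by have [] := Imul a _ (eI i).
Qed.

End ApproximateIdentity.

End BanachAlgebra.

Theorem corollary4p7 (R : realType) (A : banachAlgebraType R[i])
    (hA : forall I : set A, closed I -> two_sided_ideal I ->
      admits_quasi_central_approximate_identity I)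
    (L : set A) (hL : linear_subspace L) (hLc : closed L) :
  lie_ideal L <->
  exists I : set A,
    [/\ closed I, two_sided_ideal I,
        closure (bracket_span I setT) `<=` L &
        L `<=` bracket_into (closure (bracket_span I setT))].
Proof.
split=> [hLie|[I [Ic Iid IAL LN]]]; last first.
  split=> // a x Lx; rewrite -bracketN; apply: linear_subspaceN => //.
  exact/IAL/LN.
have IA := closed_ideal_span_closed_ideal (bracket_span L L).
have [Ic Iid] := IA.
exists (closed_ideal_span (bracket_span L L)); split=> //.
  rewrite [X in _ `<=` X]((closure_id L).1 hLc); apply: closureS.
  by apply: bracket_span_sub => // w b Iw _; exact: bracket_ideal_span_sub.
(* It is enough that [[x, a]] lies in the ideal, which semiprimeness yields because the ideal
   contains [[L, L]]. *)
move=> x Lx a; apply: bracket_mem_closure => //.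
apply: (bracket_mem_closed_ideal hA L) => // y z Ly Lz.
by apply: sub_gen_smallest; exact: bracket_span_bracket.
Qed.
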